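(* For any positive integers $\delta$ and $n$, in the cell-probe model with $w$ bits per cell, the expected running time of any algorithm solving the online multiplication problem on two $n$-digit numbers $X,Y$ chosen uniformly at random from $[q^n]$ is $\Omega\left(\frac{\delta}{w}n\log n\right)$, where $q=2^\delta$ is the base. The same bound holds even when the algorithm has full access to every digit of $Y$ from the start (only the digits of $X$ arriving online), and also when $Y=K_{q,n}$ is fixed (with $X$ uniformly random).
   Context: $[m]=\{0,\dots,m-1\}$. For a nonnegative integer $X$, $X[i]$ is its $i$th digit in base $q$, counting from $0$ at the least significant end. Online multiplication problem: inputs $X,Y\in[q^n]$, $Z=X\times Y$; the algorithm must output $Z[0],\dots,Z[n-1]$ in order, and when outputting $Z[i]$ it may use only the digits $X[0],\dots,X[i]$ and $Y[0],\dots,Y[i]$ (the digits arrive in pairs, least significant first, and $Z[i]$ is output before the next pair arrives). $K_{q,n}$ is the largest number in $[q^n]$ whose binary expansion has bit $i$ (counting from $i=0$ at the least significant end) equal to $1$ if and only if $i$ is a power of two. Cell-probe model: memory of cells of $w$ bits (each cell can hold the address of any cell); computation free, no state between operations except memory; running time = number of cell reads/writes. *)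

(* Defs.v *)
From mathcomp Require Import all_boot all_order all_algebra.
From mathcomp Require Import reals exp.
Set Implicit Arguments.
Unset Strict Implicit.
Unset Printing Implicit Defensive.
Import Order.TTheory GRing.Theory Num.Theory.

Local Open Scope nat_scope.

(* The i-th base-q digit of x, digit 0 being the least significant one. *)
Definition digit (q x i : nat) : nat := x %/ q ^ i %% q.

Definition is_pow2 (i : nat) : bool := [exists j : 'I_i, i == 2 ^ j].

(* The binary expansion of x is its bits 0, ..., trunc_log 2 x (up to the
   leading one); no condition is put on the zeros above it. *)
Definition ones_at_pow2 (x : nat) : bool :=
  [forall i : 'I_(trunc_log 2 x).+1, (digit 2 x i == 1) == is_pow2 i].

Definition K (q n : nat) : nat :=
  \max_(x < q ^ n | ones_at_pow2 x) (x : nat).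

Section CellProbe.

(* There are m cells of w bits.  That a cell can hold the address of any cell
   is the condition m <= 2 ^ w, which is a hypothesis of the theorem. *)
Variables w m : nat.

Definition cell := w.-tuple bool.
Definition memory := {ffun 'I_m -> cell}.

(* The treatment of one online operation.  Since computation is free, this is
   an arbitrary decision tree: the next probe, and finally the number that is
   output, may depend on everything read so far during this operation. *)
Inductive operation : Type :=
| Output (z : nat)
| Read (a : 'I_m) (k : cell -> operation)
| Write (a : 'I_m) (v : cell) (k : operation).

Record outcome := Outcome { probes : nat; answer : nat; final : memory }.

Definition count_probe (o : outcome) : outcome :=
  Outcome (probes o).+1 (answer o) (final o).

Definition update (s : memory) (a : 'I_m) (v : cell) : memory :=
  [ffun b => if b == a then v else s b].

Fixpoint exec (p : operation) (s : memory) : outcome :=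
  match p with
  | Output z => Outcome 0 z s
  | Read a k => count_probe (exec (k (s a)) s)
  | Write a v k => count_probe (exec k (update s a v))
  end.

(* An online algorithm receiving one item of type I per operation.  The
   operation number i is known for free, and the initial contents of the
   memory are chosen by the algorithm; apart from this, operation i sees only
   the i-th item and the memory left by operation i - 1. *)
Record algorithm (I : Type) := Algorithm {
  init : memory;
  step : nat -> I -> operation
}.

Section Run.
Variables (I : Type) (A : algorithm I) (input : nat -> I).

Fixpoint mem_before (i : nat) : memory :=
  if i is j.+1 then final (exec (step A j (input j)) (mem_before j))
  else init A.

Definition run (i : nat) : outcome :=
  exec (step A i (input i)) (mem_before i).

Definition running_time (n : nat) : nat := \sum_(i < n) probes (run i).

Definition multiplies (q n X Y : nat) : Prop :=
  forall i : nat, i < n -> answer (run i) = digit q (X * Y) i.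

End Run.
End CellProbe.

Definition digit_pairs (q X Y i : nat) : nat * nat := (digit q X i, digit q Y i).

Local Open Scope ring_scope.

(* Expectation of f under the uniform distribution on T. *)
Definition expectation_unif (R : realType) (T : finType) (f : T -> nat) : R :=
  (\sum_(t : T) (f t)%:R) / #|T|%:R.

Definition log2 (R : realType) (n : nat) : R := ln (n%:R : R) / ln 2.

(* Main.v *)
(** The proof measures information transfer over a binary tree of operations.
    For a node whose left and right halves are the operations [a, a + l) and
    [a + l, a + 2l), only the cells probed in both halves can tell the right half
    anything about the l digits of X that arrived in the left half.  The answers
    of the right half are digits l, ..., 2l - 1 of C + xY, where x is the number
    formed by those digits, so if the fibres of x |-> these digits are small,
    then most x need about delta * l / w common cells.  Summed over all nodes, the
    numbers of common cells are bounded by the number of probes.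

    With N = q ^ l, two elements of a fibre differ by some d such that d * Y is
    within N of a multiple of N ^ 2.  For random Y there are O(1) such d on
    average.  For Y = K q n, with 2 ^ p the leading power of two of Y mod N ^ 2
    and s = 2 L - p (where N = 2 ^ L), there are O(2 ^ (L - s)) of them because
    d * Y wraps around the modulus few times, and O(2 ^ s) of them because the
    leading term contributes only d mod 2 ^ s; so there are O(sqrt N). *)
Require Import Defs.
From mathcomp Require Import all_boot all_order all_algebra.
From mathcomp Require Import reals exp.
From mathcomp Require Import zify ring.
Set Implicit Arguments.
Unset Strict Implicit.
Unset Printing Implicit Defensive.
Import Order.TTheory GRing.Theory Num.Theory.
Local Open Scope nat_scope.

(** * Counting and digit expansions *)

Lemma card_fibres (T U : finType) (A : {set T}) (f : T -> U) (D : {set U}) B :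
  (forall x, x \in A -> f x \in D) ->
  (forall u, u \in D -> #|[set x in A | f x == u]| <= B) ->
  #|A| <= #|D| * B.
Proof.
move=> fD fB; rewrite -sum1_card (partition_big f (mem D)) //=.
rewrite -sum_nat_const; apply: leq_sum => u /fB; apply: leq_trans.
by rewrite -sum1_card; under [leqRHS]eq_bigl do rewrite inE.
Qed.

(** Markov's inequality: [f] exceeds [k] on at least half of [T]. *)
Lemma markov_card (T : finType) (f : T -> nat) k :
  #|[set x | f x <= k]|.*2 <= #|T| ->
  k.+1 * #|T| <= (\sum_x f x).*2.
Proof.
set A := [set x | _] => cA.
have : k.+1 * #|~: A| <= \sum_x f x.
  rewrite mulnC -sum_nat_const big_mkcond; apply: leq_sum => x _.
  by rewrite !inE -ltnNge; case: ifP.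
have := cardsC A.
by nia.
Qed.

Lemma modn_eq_digits q x y l :
  (forall i, i < l -> digit q x i = digit q y i) -> x = y %[mod q ^ l].
Proof.
elim: l => [|l IHl] eqd; first by rewrite expn0 !modn1.
have splitd u : u %% q ^ l.+1 = digit q u l * q ^ l + u %% q ^ l.
  case: (posnP q) => [->|q0].
    by rewrite exp0n // modn0 /digit modn0 -divn_eq.
  have ql : 0 < q ^ l by rewrite expn_gt0 q0.
  rewrite {1}(divn_eq u (q ^ l)) {1}(divn_eq (u %/ q ^ l) q) mulnDl -mulnA -expnS.
  rewrite -addnA modnMDl modn_small // -/(digit q u l).
  have : digit q u l < q by rewrite ltn_mod.
  have : u %% q ^ l < q ^ l by rewrite ltn_mod.
  by rewrite expnS; nia.
by rewrite !splitd eqd // IHl // => i il; apply: eqd; rewrite ltnS ltnW.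
Qed.

(** * Cells probed by an algorithm *)

Section CellProbe.
Variables w m : nat.
Implicit Types (p : operation w m) (s : memory w m).

Fixpoint probed p s : {set 'I_m} :=
  match p with
  | Output _ => set0
  | Read a k => a |: probed (k (s a)) s
  | Write a v k => a |: probed k (update s a v)
  end.

Lemma card_probed p s : #|probed p s| <= probes (exec p s).
Proof.
elim: p s => [z|a k IH|a v k IH] s /=; first by rewrite cards0.
- by rewrite cardsU1 -add1n leq_add ?leq_b1.
- by rewrite cardsU1 -add1n leq_add ?leq_b1.
Qed.

Lemma final_unprobed p s b : b \notin probed p s -> final (exec p s) b = s b.
Proof.
elim: p s => [z|a k IH|a v k IH] s //=; rewrite !inE negb_or => /andP[ba bP].
- exact: IH.
- by rewrite IH // ffunE (negPf ba).
Qed.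

(** Agreement on the probed cells keeps both executions on one branch of the decision tree, with the
    same writes, so agreement at any other cell persists too. *)
Lemma exec_local p s s' :
  {in probed p s, s =1 s'} ->
  answer (exec p s) = answer (exec p s') /\
  (forall b, s b = s' b -> final (exec p s) b = final (exec p s') b).
Proof.
elim: p s s' => [z|a k IH|a v k IH] s s' //= eqs.
- rewrite -(eqs a) ?setU11 //; apply: IH => b bP.
  by apply: eqs; rewrite inE bP orbT.
- have [|-> eF] := IH (update s a v) (update s' a v).
    move=> b bP; rewrite !ffunE; case: ifP => // _.
    by apply: eqs; rewrite inE bP orbT.
  by split=> // b eb; apply: eF; rewrite !ffunE eb.
Qed.

(** Raising the radius by one overwrites one more cell, with at most [m * 2 ^ w <= 2 ^ (2 * w)]
    choices of address and value. *)
Lemma hamming_ball s k :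
  m <= 2 ^ w ->
  #|[set h : memory w m | #|[set a | h a != s a]| <= k]| <= 2 ^ (2 * w * k).
Proof.
move=> mw; set ball := fun k => [set h : memory w m | #|[set a | h a != s a]| <= k].
rewrite -/(ball k).
have ball0 : #|ball 0| <= 1.
  rewrite -(cards1 s) subset_leq_card //; apply/subsetP => h; rewrite !inE leqn0.
  rewrite cards_eq0 => /eqP/setP eh; apply/eqP/ffunP => a.
  by have := eh a; rewrite !inE => /negbFE/eqP.
elim: k => [|k IH]; first by rewrite muln0.
have [m0|/card_gt0P[a0 _]] := posnP #|'I_m|.
  rewrite (@leq_trans 1) ?expn_gt0 //; apply: leq_trans ball0.
  apply/subset_leq_card/subsetP => h _; rewrite inE.
  by rewrite (leq_trans (max_card _)) // m0.
pose g (c : memory w m * ('I_m * cell w)) := update c.1 c.2.1 c.2.2.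
have sub : ball k.+1 \subset g @: setX (ball k) setT.
  apply/subsetP => h; rewrite inE => hk; apply/imsetP.
  have [/eqP|/set0Pn[a]] := boolP ([set a | h a != s a] == set0).
    move=> h0; exists (h, (a0, h a0)).
      by rewrite !inE h0 cards0.
    by apply/ffunP => b; rewrite ffunE /=; case: eqP => // ->.
  rewrite inE => ha; exists (update h a (s a), (a, h a)).
    rewrite !inE andbT -ltnS (leq_trans _ hk) // proper_card //.
    apply/properP; split.
      by apply/subsetP => b; rewrite !inE ffunE; case: ifP => // /eqP->; rewrite eqxx.
    by exists a; rewrite !inE ?ffunE ?eqxx.
  by apply/ffunP => b; rewrite !ffunE /=; case: eqP => // ->.
apply: leq_trans (subset_leq_card sub) _; apply: leq_trans (leq_imset_card _ _) _.
rewrite cardsX cardsT card_prod card_ord card_tuple card_bool mulnSr expnD.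
by rewrite leq_mul // mul2n -addnn expnD leq_mul.
Qed.

Section Run.
Variables (I : Type) (A : algorithm w m I).
Implicit Types input : nat -> I.

Definition probed_at input t := probed (step A t (input t)) (mem_before A input t).

Definition probed_in input a l := \bigcup_(t < l) probed_at input (a + t).

Lemma probed_inD input a l1 l2 :
  probed_in input a (l1 + l2) = probed_in input a l1 :|: probed_in input (a + l1) l2.
Proof.
rewrite /probed_in big_split_ord; congr (_ :|: _).
by apply: eq_bigr => t _; rewrite addnA.
Qed.

Lemma mem_before_unprobed input a l b :
  b \notin probed_in input a l -> mem_before A input (a + l) b = mem_before A input a b.
Proof.
elim: l => [|l IH]; first by rewrite addn0.
rewrite -addn1 probed_inD inE negb_or => /andP[/IH <-].
rewrite /probed_in big_ord1 addn0 addn1 addnS => bP /=.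
exact: final_unprobed.
Qed.

Lemma eq_mem_before input input' a :
  (forall i, i < a -> input i = input' i) -> mem_before A input a = mem_before A input' a.
Proof.
elim: a => //= a IH eqi; rewrite eqi // IH // => i ia.
by apply: eqi; rewrite ltnW.
Qed.

(** Restarting from an arbitrary memory makes the answers of a right half a function of that memory
    and of the later digits. *)
Definition resume a s := Algorithm s (fun t => step A (a + t)).

Lemma run_resume input a (h : memory w m) l :
  {in probed_in input a l, mem_before A input a =1 h} ->
  forall t, t < l ->
    answer (run A input (a + t)) = answer (run (resume a h) (fun t => input (a + t)) t).
Proof.
move=> eqh.
have inv t : t <= l -> {in probed_in input a l,
    mem_before A input (a + t) =1 mem_before (resume a h) (fun t => input (a + t)) t}.
  elim: t => [|t IH] tl b bP; first by rewrite addn0 eqh.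
  rewrite addnS /=; apply: (proj2 (exec_local _)); last by apply: IH => //; apply: ltnW.
  move=> c cP; apply: IH => //; first exact: ltnW.
  by apply/bigcupP; exists (Ordinal tl).
move=> t tl; apply: (proj1 (exec_local _)) => c cP.
by apply: inv; [apply: ltnW|apply/bigcupP; exists (Ordinal tl)].
Qed.

(** Total information transfer in the complete binary tree whose leaves are the operations [a], ...,
    [a + 2 ^ k - 1]. *)
Fixpoint transfer input k a : nat :=
  if k is j.+1 then
    transfer input j a + transfer input j (a + 2 ^ j) +
    #|probed_in input a (2 ^ j) :&: probed_in input (a + 2 ^ j) (2 ^ j)|
  else 0.

(* Inclusion-exclusion at every node: the cells common to both halves are
   exactly those counted twice. *)
Lemma transfer_le_probes input k a :
  transfer input k a + #|probed_in input a (2 ^ k)| <=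
  \sum_(t < 2 ^ k) probes (run A input (a + t)).
Proof.
elim: k a => [|k IH] a /=.
  by rewrite /probed_in expn0 !big_ord1 add0n card_probed.
rewrite expnS mul2n -addnn probed_inD big_split_ord /=.
under [X in _ <= _ + X]eq_bigr do rewrite addnA.
have := leq_add (IH a) (IH (a + 2 ^ k)).
have := cardsUI (probed_in input a (2 ^ k)) (probed_in input (a + 2 ^ k) (2 ^ k)).
have arith (u i l r x y s s' : nat) :
  u + i = l + r -> x + l + (y + r) <= s + s' -> x + y + i + u <= s + s' by lia.
exact: arith.
Qed.

Lemma transfer_le_running_time input n k :
  2 ^ k <= n -> transfer input k 0 <= running_time A input n.
Proof.
move=> kn; apply: leq_trans (leq_trans (leq_addr _ _) (transfer_le_probes input k 0)) _.
rewrite /running_time -!(big_mkord xpredT (fun t => probes (run A input t))).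
by rewrite (big_cat_nat (leq0n _) kn) leq_addr.
Qed.

End Run.
End CellProbe.
(** * Information transfer at one node *)

(* The map x |-> digits L, ..., 2L - 1 (in base 2) of C + xY retains at least b
   of the L bits of x, whatever the offset C due to the other digits of X. *)
Definition spread L Y b := forall C z,
  #|[set x : 'I_(2 ^ L) | (C + x * Y) %/ 2 ^ L %% 2 ^ L == z]| * 2 ^ b <= 2 ^ L.

Lemma digit_modn q X i a : i < a -> digit q (X %% q ^ a) i = digit q X i.
Proof.
move=> /subnKC <-; rewrite /digit; set c := a - i.+1.
have [->|q0] := posnP q.
  by rewrite addSn exp0n // modn0.
have -> : q ^ (i.+1 + c) = q ^ c * q * q ^ i.
  by rewrite -expnSr -expnD; congr (_ ^ _); lia.
by rewrite {2}(divn_eq X (q ^ c * q * q ^ i)) mulnA divnMDl ?expn_gt0 ?q0 // mulnA modnMDl.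
Qed.

Lemma digitD q X a t : digit q X (a + t) = digit q (X %/ q ^ a) t.
Proof. by rewrite /digit expnD divnMA. Qed.

Section Node.
Variables (delta n w m : nat).
Let q := 2 ^ delta.
Variables (A : algorithm w m nat) (Y : nat).
Hypothesis mul_ok : forall X : 'I_(q ^ n), multiplies A (digit q X) q n X Y.
Hypothesis mw : m <= 2 ^ w.

Definition common (X a l : nat) :=
  #|probed_in A (digit q X) a l :&: probed_in A (digit q X) (a + l) l|.

Let qX k : 0 < q ^ k.
Proof. by rewrite expn_gt0 expn_gt0. Qed.

(** Encoding argument: once the digits outside the left half are fixed, the right half depends only
    on a memory in a Hamming ball of radius [k], and each such memory leaves at most one fibre of
    the map in [spread]. *)
Lemma card_few_common a l b k : a + l + l <= n -> spread (delta * l) Y b ->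
  #|[set X : 'I_(q ^ n) | common X a l <= k]| * 2 ^ b <= q ^ n * 2 ^ (2 * w * k).
Proof.
move=> aln sp; set few := [set X | _].
have keyP (X : 'I_(q ^ n)) : X %/ q ^ (a + l) < q ^ (n - (a + l)).
  by rewrite ltn_divLR // -expnD subnK ?ltn_ord // (leq_trans _ aln) ?leq_addr.
pose key (X : 'I_(q ^ n)) := (Ordinal (ltn_pmod X (qX a)), Ordinal (keyP X)).
suff: #|few| <= #|[set: 'I_(q ^ a) * 'I_(q ^ (n - (a + l)))]| *
                 (2 ^ (2 * w * k) * (q ^ l %/ 2 ^ b)).
  rewrite cardsT card_prod !card_ord => le.
  apply: leq_trans (leq_mul le (leqnn (2 ^ b))) _.
  have -> : q ^ n = q ^ a * q ^ (n - (a + l)) * q ^ l.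
    by rewrite -!expnD; congr (_ ^ _); lia.
  rewrite -!mulnA; do 2 apply: leq_mul => //.
  by rewrite mulnC; apply: leq_mul; rewrite ?leq_trunc_div.
apply: (card_fibres (f := key)) => [X _|u _]; first by rewrite inE.
set F := [set _ in _ | _].
(* Any member of the class can provide the centre: the memory before [a] depends only on the low
   digits, which the class shares. *)
have [->|/set0Pn[X0 X0F]] := eqVneq F set0; first by rewrite cards0.
set s0 := mem_before A (digit q X0) a.
(* The memory the right half cannot tell apart from the actual one; it differs
   from s0 only in common cells. *)
pose hyb (X : 'I_(q ^ n)) : memory w m :=
  [ffun c => if c \in probed_in A (digit q X) (a + l) l
             then mem_before A (digit q X) (a + l) c else s0 c].
have sameF X X' : X \in F -> X' \in F ->
    X = X' %[mod q ^ a] /\ X %/ q ^ (a + l) = X' %/ q ^ (a + l).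
  by rewrite !inE => /andP[_ /eqP <-] /andP[_ /eqP []].
have ballP := leq_mul (hamming_ball s0 k mw) (leqnn (q ^ l %/ 2 ^ b)).
apply: leq_trans ballP; apply: (card_fibres (f := hyb)).
- move=> X XF; rewrite inE; have := XF; rewrite !inE => /andP[Xk _].
  apply: leq_trans Xk; apply/subset_leq_card/subsetP => c.
  rewrite !inE ffunE; case: ifP => [cR|]; last by rewrite eqxx.
  rewrite andbT; apply: contraR => /mem_before_unprobed ->; apply/eqP.
  congr (fun_of_fin _ c); apply: eq_mem_before => i ia.
  by rewrite -(digit_modn q X ia) (proj1 (sameF _ _ XF X0F)) digit_modn.
- move=> h _; rewrite leq_divRL ?expn_gt0 //; set H := [set _ in _ | _].
  have [->|/set0Pn[X1 X1H]] := eqVneq H set0; first by rewrite cards0.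
  have HF X : X \in H -> X \in F by rewrite inE => /andP[].
  have X1F := HF _ X1H.
  pose lo := X1 %% q ^ a; pose hi := X1 %/ q ^ (a + l).
  (* The offset due to the fixed digits; the floor is harmless because the middle digits contribute
     a multiple of [q ^ a]. *)
  pose C := (lo + q ^ (a + l) * hi) * Y %/ q ^ a.
  pose z := X1 * Y %/ q ^ (a + l) %% q ^ l.
  pose mid (X : nat) := X %/ q ^ a %% q ^ l.
  have splitX X : X \in F -> X = lo + q ^ a * mid X + q ^ (a + l) * hi :> nat.
    move=> XF; have [e1 e2] := sameF _ _ XF X1F.
    rewrite {1}(divn_eq X (q ^ a)) {1}(divn_eq (X %/ q ^ a) (q ^ l)) /lo /hi /mid.
    by rewrite -e1 -e2 expnD divnMA; lia.
  have qlE : q ^ l = 2 ^ (delta * l) by rewrite expnM.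
  rewrite qlE; apply: leq_trans (sp C z); rewrite leq_mul2r; apply/orP; right.
  have midP X : mid X < 2 ^ (delta * l) by rewrite -qlE ltn_mod.
  pose f (X : 'I_(q ^ n)) := Ordinal (midP X).
  rewrite -(card_in_imset (f := f)); last first.
    move=> X X' /HF XF /HF XF' /(congr1 val) /= e.
    by apply: val_inj; rewrite /= (splitX _ XF) (splitX _ XF') e.
  apply/subset_leq_card/subsetP => _ /imsetP[X XH ->].
  have XF := HF _ XH.
  rewrite inE /= -qlE.
  have -> : C + mid X * Y = X * Y %/ q ^ a.
    rewrite {2}(splitX _ XF) /C.
    have -> : (lo + q ^ a * mid X + q ^ (a + l) * hi) * Y =
      mid X * Y * q ^ a + (lo + q ^ (a + l) * hi) * Y by lia.
    by rewrite divnMDl // addnC.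
  rewrite -divnMA -expnD; apply/eqP/modn_eq_digits => t tl.
  rewrite -!digitD.
  have tn : a + l + t < n by apply: leq_trans aln; rewrite ltn_add2l.
  (* Both right halves resume from [h] and receive equal digits, hence give equal answers. *)
  rewrite -!mul_ok // !(run_resume (h := h) (l := l)) //.
  + congr (answer (exec (step _ _ _) _)).
    * by rewrite !digitD (proj2 (sameF _ _ XF X1F)).
    * apply: eq_mem_before => i _.
      by rewrite !digitD (proj2 (sameF _ _ XF X1F)).
  + by move=> c cP; move: X1H; rewrite inE => /andP[_ /eqP <-]; rewrite ffunE cP.
  + by move=> c cP; move: XH; rewrite inE => /andP[_ /eqP <-]; rewrite ffunE cP.
Qed.

Lemma sum_common_ge a l b : 0 < w -> a + l + l <= n -> spread (delta * l) Y b ->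
  b * q ^ n <= 4 * w * \sum_(X < q ^ n) common X a l.
Proof.
move=> w0 aln sp; case: b sp => [|b] sp; first by rewrite mul0n.
(* [b] is now one less than in the statement; the spare factor 2 makes the inputs with at most [k]
   common cells at most half of all. *)
pose k := b %/ (2 * w).
have := card_few_common k aln sp.
have kb : 2 ^ (2 * w * k) <= 2 ^ b by rewrite leq_pexp2l // mulnC leq_trunc_div.
move/leq_trans/(_ (leq_mul (leqnn _) kb)).
rewrite expnS mulnA leq_mul2r expn_eq0 /= muln2.
move=> few2; have := markov_card (T := 'I_(q ^ n)) (f := fun X => common X a l) (k := k).
rewrite card_ord => /(_ few2) le.
have bk : b < k.+1 * (2 * w) by rewrite -ltn_divLR ?muln_gt0.
apply: leq_trans (leq_mul bk (leqnn (q ^ n))) _; rewrite mulnAC.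
apply: leq_trans (leq_mul le (leqnn (2 * w))) _.
by move: (\sum_i _) => S; lia.
Qed.

End Node.

(** [I] consists of all multipliers in the random case and of one element in the fixed case. A
    quarter of good indices per level suffices, and it may vary with the level. *)
Lemma sum_transfer_ge (I : finType) delta n w m (A : I -> algorithm w m nat)
    (Y : I -> nat) k a (q := 2 ^ delta) :
  0 < w -> m <= 2 ^ w ->
  (forall i (X : 'I_(q ^ n)), multiplies (A i) (digit q X) q n X (Y i)) ->
  (forall j, 2 ^ j.+1 <= n -> exists2 G : {set I}, #|I| <= 4 * #|G| &
     forall i, i \in G ->
       exists2 b, delta * 2 ^ j <= 16 * b & spread (delta * 2 ^ j) (Y i) b) ->
  a + 2 ^ k <= n ->
  delta * k * 2 ^ k * (#|I| * q ^ n) <=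
    512 * w * \sum_i \sum_(X < q ^ n) transfer (A i) (digit q X) k a.
Proof.
move=> w0 mw mul_ok spreadG; elim: k a => [|k IH] a akn; first by rewrite muln0.
have kn : a + 2 ^ k + 2 ^ k <= n by rewrite -addnA addnn -mul2n -expnS.
have {spreadG}[|G cG spreadG] := spreadG k; first by apply: leq_trans akn; rewrite leq_addl.
(* A good index costs [16 * (4 * w)], the share of good ones another factor 4; 512 is twice 256
   because the node spans [2 * 2 ^ k] operations. *)
have node : delta * 2 ^ k * (#|I| * q ^ n) <=
    256 * w * \sum_i \sum_(X < q ^ n) common delta (A i) X a (2 ^ k).
  have : #|G| * (delta * 2 ^ k * q ^ n) <=
      64 * w * \sum_i \sum_(X < q ^ n) common delta (A i) X a (2 ^ k).
    rewrite -sum_nat_const big_mkcond big_distrr; apply: leq_sum => i _ /=.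
    case: ifP => // /spreadG[b b16 sp].
    have := sum_common_ge (mul_ok i) mw w0 kn sp.
    rewrite -/q => le; apply: leq_trans (leq_mul b16 (leqnn (q ^ n))) _.
    rewrite -mulnA; apply: leq_trans (leq_mul (leqnn 16) le) _.
    by rewrite !mulnA.
  move: cG (2 ^ k) (q ^ n) (\sum_i _) => cG K Q S le.
  have := leq_mul cG (leqnn (delta * K * Q)); nia.
have := IH a; rewrite (leq_trans _ kn) ?leq_addr // => /(_ isT) IH1.
have {IH}IH2 := IH _ kn.
under eq_bigr do rewrite /= !big_split /=.
rewrite !big_split /= -/(common delta _ _ a (2 ^ k)).
move: node IH1 IH2; rewrite /common -/q expnS.
move: (2 ^ k) (#|I| * q ^ n) (\sum_i _) (\sum_i _) (\sum_i _) => K Q S1 S2 S3.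
nia.
Qed.
(** * Multipliers with small fibres *)

(* d * Y is at distance less than N from a multiple of N ^ 2. *)
Definition near N Y d :=
  (d * Y %% (N * N) < N) || (N * N < d * Y %% (N * N) + N).

(** The shift merges the residues on both sides of 0 into one block, as [card_progression]
    requires. *)
Lemma near_shift N Y d : 0 < N -> near N Y d ->
  (d * Y + N.-1) %% (N * N) < N + N.-1.
Proof.
move=> N0; have N20 : 0 < N * N by rewrite muln_gt0 N0.
rewrite /near -modnDml; have := ltn_pmod (d * Y) N20.
move: (d * Y %% _) => r rM.
have M0 : N <= N * N by rewrite leq_pmulr.
case/orP => rN.
  by apply: leq_ltn_trans (leq_mod _ _) _; lia.
have -> : r + N.-1 = 1 * (N * N) + (r + N.-1 - N * N) by lia.
by rewrite modnMDl; apply: leq_ltn_trans (leq_mod _ _) _; lia.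
Qed.

(** Modulo [N * N], both numbers lie in the same block of [N] consecutive residues. *)
Lemma same_block_near N Y C x d : 0 < N ->
  (C + x * Y) %/ N = (C + (x + d) * Y) %/ N %[mod N] -> near N Y d.
Proof.
move=> N0; have N20 : 0 < N * N by rewrite muln_gt0 N0.
have modn_divE u : u %/ N %% N = u %% (N * N) %/ N.
  rewrite {1}(divn_eq u (N * N)) mulnA divnMDl // modnMDl modn_small //.
  by rewrite ltn_divLR // ltn_mod.
rewrite !modn_divE mulnDl addnA; set u := C + x * Y.
rewrite -(modnDml u) -modnDmr /near.
have := ltn_pmod u N20; have := ltn_pmod (d * Y) N20.
move: (u %% _) (d * Y %% _) => {u} u r rM uM.
have [lt|ge] := ltnP (u + r) (N * N).
  rewrite (modn_small lt) => e; apply/orP; left.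
  have := divn_eq u N; have := divn_eq (u + r) N; rewrite -e.
  by have := ltn_pmod u N0; have := ltn_pmod (u + r) N0; lia.
have -> : u + r = 1 * (N * N) + (u + r - N * N) by lia.
rewrite modnMDl modn_small; last by lia.
set v := _ - _ => e; apply/orP; right.
have := divn_eq u N; have := divn_eq v N; rewrite -e.
by have := ltn_pmod u N0; have := ltn_pmod v N0; rewrite /v; lia.
Qed.

Section Fibre.
Variables (N Y C z : nat).
Hypothesis N0 : 0 < N.
Let S := [set x : 'I_N | (C + x * Y) %/ N %% N == z].

Lemma fibre_near x y : x \in S -> y \in S -> x <= y -> near N Y (y - x).
Proof.
rewrite !inE => /eqP ex /eqP ey xy; apply: (@same_block_near N Y C x) => //.
by rewrite subnKC // ex ey.
Qed.

(** Subtracting the least element embeds the fibre into the near differences. *)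
Lemma card_fibre_near : #|S| <= #|[set d : 'I_N | near N Y d]|.
Proof.
have [->|/set0Pn[x1 x1S]] := eqVneq S set0; first by rewrite cards0.
have [x0 x0S x0min] := arg_minnP (fun x : 'I_N => x : nat) x1S.
have subP (x : 'I_N) : x - x0 < N by apply: leq_ltn_trans (leq_subr _ _) _.
pose f x := Ordinal (subP x).
rewrite -(card_in_imset (f := f)); last first.
  move=> x y xS yS /(congr1 val) /= e; apply: val_inj => /=.
  by have := x0min _ xS; have := x0min _ yS; lia.
apply/subset_leq_card/subsetP => _ /imsetP[x xS ->].
by rewrite inE; apply: fibre_near => //; apply: x0min.
Qed.

(** The fibre cannot contain two consecutive numbers, so halving is injective on it. *)
Lemma card_fibre_half : ~~ odd N -> ~~ near N Y 1 -> #|S| * 2 <= N.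
Proof.
move=> evenN far1.
have halfP (x : 'I_N) : x./2 < N./2.
  have := odd_double_half x; have := odd_double_half N; rewrite (negPf evenN).
  by have := ltn_ord x; case: (odd x); lia.
pose f x := Ordinal (halfP x).
have : #|S| <= #|'I_(N./2)|.
  rewrite -(card_in_imset (f := f)) ?max_card // => x y xS yS /(congr1 val) /= e.
  apply: val_inj => /=; apply/eqP.
  have := odd_double_half x; have := odd_double_half y; rewrite -e => hy hx.
  have step (u v : 'I_N) : u \in S -> v \in S -> u < v <= u.+1 -> False.
    move=> uS vS /andP[uv vu]; have := fibre_near uS vS (ltnW uv).
    have -> : v - u = 1 by lia.
    exact/negP.
  case: (ltngtP x y) => // xy; exfalso.
  - by apply: (step x y) => //; move: hx hy; case: (odd x); case: (odd y); lia.
  - by apply: (step y x) => //; move: hx hy; case: (odd x); case: (odd y); lia.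
by rewrite card_ord; have := odd_double_half N; rewrite (negPf evenN); lia.
Qed.

End Fibre.

Lemma spread1 L Y : 0 < L -> ~~ near (2 ^ L) Y 1 -> spread L Y 1.
Proof.
move=> L0 far1 C z; apply: card_fibre_half; rewrite ?expn_gt0 //.
by rewrite oddX negb_or -lt0n L0.
Qed.

Lemma spread_near L Y b :
  #|[set d : 'I_(2 ^ L) | near (2 ^ L) Y d]| * 2 ^ b <= 2 ^ L -> spread L Y b.
Proof.
move=> le C z; apply: leq_trans le; rewrite leq_mul2r card_fibre_near ?orbT //.
by rewrite expn_gt0.
Qed.

(* A block of W consecutive residues meets each period of length M in at most
   V terms of the progression. *)
Lemma card_progression alpha beta M W U Q V : 0 < alpha -> 0 < M ->
  (forall d, d < U -> alpha * d + beta < Q * M) -> W <= alpha * V ->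
  #|[set d : 'I_U | (alpha * d + beta) %% M < W]| <= Q * V.
Proof.
move=> a0 M0 QP WV; set S := [set d | _].
have [->|/set0Pn[d0 d0S]] := eqVneq S set0; first by rewrite cards0.
have Q0 : 0 < Q.
  by have := QP _ (ltn_ord d0); case: (Q) => //; rewrite mul0n ltn0.
have V0 : 0 < V.
  move: d0S; rewrite inE => h; have := leq_ltn_trans (leq0n _) (leq_trans h WV).
  by rewrite muln_gt0 => /andP[].
pose f (d : 'I_U) : 'I_Q.-1.+1 * 'I_V.-1.+1 :=
  (inord ((alpha * d + beta) %/ M), inord ((alpha * d + beta) %% M %/ alpha)).
have qP (d : 'I_U) : (alpha * d + beta) %/ M < Q.-1.+1.
  by rewrite prednK // ltn_divLR // QP.
have rP (d : 'I_U) : d \in S -> (alpha * d + beta) %% M %/ alpha < V.-1.+1.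
  by rewrite inE => h; rewrite prednK // ltn_divLR // (leq_trans h) // mulnC.
apply: (@leq_trans #|{: 'I_Q.-1.+1 * 'I_V.-1.+1}|); last first.
  by rewrite card_prod !card_ord !prednK.
rewrite -(card_in_imset (f := f)) ?max_card // => x y xS yS [] /(congr1 val) e1 /(congr1 val).
rewrite /= !inordK ?rP // => e2; move: e1; rewrite /= !inordK ?qP // => e1.
apply: val_inj => /=.
have := divn_eq (alpha * x + beta) M; have := divn_eq (alpha * y + beta) M.
have := divn_eq ((alpha * x + beta) %% M) alpha.
have := divn_eq ((alpha * y + beta) %% M) alpha.
rewrite e1 e2; move: (_ %/ _ * _) (_ %/ _ * _) => u v h1 h2 h3 h4.
have := ltn_pmod ((alpha * x + beta) %% M) a0.
have := ltn_pmod ((alpha * y + beta) %% M) a0.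
move: (_ %% _ %% _) (_ %% _ %% _) h1 h2 => r1 r2 h1 h2.
have [xy|xy|//] := ltngtP x y; nia.
Qed.

Lemma near_modn N Y d : near N (Y %% (N * N)) d = near N Y d.
Proof. by rewrite /near modnMmr. Qed.

Lemma card_near1 N R : 0 < N ->
  #|[set Y : 'I_(N * N * R) | near N Y 1]| <= R * (N + N.-1).
Proof.
move=> N0; set S := [set Y | _].
have NN0 : 0 < N * N by rewrite muln_gt0 N0.
have qP (Y : 'I_(N * N * R)) : Y %/ (N * N) < R by rewrite ltn_divLR // (leq_trans (ltn_ord Y)) // mulnC.
have [->|/set0Pn[Y0 Y0S]] := eqVneq S set0; first by rewrite cards0.
pose f Y : 'I_R * 'I_(N + N.-1).-1.+1 := (Ordinal (qP Y), inord ((Y + N.-1) %% (N * N))).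
have E : (N + N.-1).-1.+1 = N + N.-1 by lia.
apply: (@leq_trans #|{: 'I_R * 'I_(N + N.-1).-1.+1}|); last first.
  by rewrite card_prod !card_ord E.
have rP (Y : 'I_(N * N * R)) : Y \in S -> (Y + N.-1) %% (N * N) < (N + N.-1).-1.+1.
  by rewrite inE E => /(near_shift N0); rewrite mul1n.
rewrite -(card_in_imset (f := f)) ?max_card // => x y xS yS [] e1 /(congr1 val).
rewrite /= !inordK ?rP // => /eqP; rewrite eqn_modDr => /eqP e2.
by apply: val_inj; rewrite /= (divn_eq x (N * N)) (divn_eq y (N * N)) e1 e2.
Qed.

(** As [Y] varies, [d * Y] is a progression of difference [d]: at most [d * R + 1] turns around the
    modulus, with at most [2 * N %/ d + 1] hits in each. *)
Lemma card_near_multiplier N R d : 0 < R -> 0 < d < N ->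
  #|[set Y : 'I_(N * N * R) | near N Y d]| <= 5 * (N * R).
Proof.
move=> R0 /andP[d0 dN]; have N0 : 0 < N by apply: leq_trans dN.
have := @card_progression d N.-1 (N * N) (N + N.-1) (N * N * R) (d * R).+1 (2 * N %/ d).+1 d0.
rewrite muln_gt0 N0 => /(_ isT) prog.
apply: (@leq_trans #|[set Y : 'I_(N * N * R) | (d * Y + N.-1) %% (N * N) < N + N.-1]|).
  by apply/subset_leq_card/subsetP => Y; rewrite !inE; apply: near_shift.
apply: leq_trans (prog _ _) _.
- move=> Y YU; have : d * Y <= d * (N * N * R) by rewrite leq_mul2l (ltnW YU) orbT.
  have : N <= N * N by rewrite leq_pmulr.
  by rewrite mulSn (mulnAC d R) mulnA; move: (N * N) (d * Y) => M Z; nia.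
- by have := divn_eq (2 * N) d; have := ltn_pmod (2 * N) d0; nia.
- have := leq_trunc_div (2 * N) d; move: (_ %/ _) => v vd.
  have : v <= 2 * N by nia.
  by nia.
Qed.

Lemma sum_card_near N R : 0 < N -> 0 < R ->
  \sum_(Y < N * N * R) #|[set d : 'I_N | near N Y d]| <= 6 * (N * N * R).
Proof.
move=> N0 R0.
have -> : \sum_(Y < N * N * R) #|[set d : 'I_N | near N Y d]| =
          \sum_(d < N) #|[set Y : 'I_(N * N * R) | near N Y d]|.
  under eq_bigr do rewrite -sum1dep_card big_mkcond.
  rewrite exchange_big; apply: eq_bigr => d _.
  by rewrite -sum1dep_card [RHS]big_mkcond.
(* Zero is near for every [Y], which accounts for one of the six [N * N * R]. *)
rewrite (bigD1 (Ordinal N0)) //=.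
have := max_card (mem [set Y : 'I_(N * N * R) | near N Y 0]); rewrite card_ord => le0.
have : \sum_(d < N | d != Ordinal N0) #|[set Y : 'I_(N * N * R) | near N Y d]|
       <= \sum_(d < N) 5 * (N * R).
  rewrite [leqRHS](bigID (fun d => d != Ordinal N0)) /=; apply: leq_trans (leq_addr _ _).
  apply: leq_sum => d d0; apply: card_near_multiplier => //.
  by rewrite ltn_ord andbT lt0n; apply: contra d0 => /eqP d0; apply/eqP/val_inj.
rewrite sum_nat_const card_ord.
by move: le0; move: #|_| (\sum_(_ | _) _) => u v; nia.
Qed.

Lemma spread_most L R U (N := 2 ^ L) : 0 < L -> 0 < R -> U = N * N * R ->
  exists2 G : {set 'I_U}, U <= 4 * #|G| &
    forall Y : 'I_U, Y \in G -> exists2 b, L <= 16 * b & spread L Y b.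
Proof.
move=> L0 R0 ->; have N0 : 0 < N by rewrite expn_gt0.
have [L16|L16] := leqP L 16.
  exists [set Y : 'I_(N * N * R) | ~~ near N Y 1]; last first.
    by move=> Y; rewrite inE => /(spread1 L0) ?; exists 1.
  have := card_near1 R N0; set S := [set Y | _] => cS.
  have -> : [set Y : 'I_(N * N * R) | ~~ near N Y 1] = ~: S by apply/setP => Y; rewrite !inE.
  have := cardsC S; rewrite card_ord.
  have : 4 * (N + N.-1) <= 3 * (N * N).
    have : 2 <= N by rewrite /N -[2]expn1 leq_pexp2l.
    by move=> N2; case: N N2 {cS S N0} => // -[|k] // _; nia.
  by move: cS; move: (N * N) (N + N.-1) #|S| #|~: S| => M W s t; nia.
(* The average is at most 6, so at most three quarters of the [Y] reach 8; and 7 is below [2 ^ 3],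
   whence [b = L - 3]. *)
set G := [set Y : 'I_(N * N * R) | #|[set d : 'I_N | near N Y d]| <= 7].
exists G.
  have : #|~: G| * 8 <= 6 * (N * N * R).
    apply: leq_trans (sum_card_near N0 R0).
    rewrite -sum_nat_const big_mkcond; apply: leq_sum => Y _.
    by rewrite !inE -ltnNge; case: ifP.
  have := cardsC G; rewrite card_ord.
  by move: (N * N * R) #|G| #|~: G| => M g g'; lia.
move=> Y; rewrite inE => c7; exists (L - 3); first by lia.
apply: spread_near; apply: leq_trans (leq_mul c7 (leqnn _)) _.
have -> : 2 ^ L = 2 ^ 3 * 2 ^ (L - 3) by rewrite -expnD; congr (_ ^ _); lia.
by rewrite leq_mul2r orbT.
Qed.

(** * The multiplier with ones at the powers of two *)

Definition pow2sum N := \sum_(i < N) is_pow2 i * 2 ^ i.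

Lemma pow2sumS N : pow2sum N.+1 = is_pow2 N * 2 ^ N + pow2sum N.
Proof. by rewrite /pow2sum big_ord_recr addnC. Qed.

Lemma ltn_pow2sum N : pow2sum N < 2 ^ N.
Proof.
elim: N => [|N IH]; first by rewrite /pow2sum big_ord0.
by rewrite pow2sumS expnS; case: is_pow2; lia.
Qed.

Lemma leq_pow2sum M N : M <= N -> pow2sum M <= pow2sum N.
Proof.
by move/subnKC <-; elim: (N - M) => [|k IH]; rewrite ?addn0 // addnS pow2sumS; lia.
Qed.

Lemma pow2sum_modn M N : M <= N -> pow2sum N %% 2 ^ M = pow2sum M.
Proof.
move/subnKC <-; elim: (N - M) => [|k IH]; first by rewrite addn0 modn_small ?ltn_pow2sum.
by rewrite addnS pow2sumS expnD mulnCA mulnC modnMDl.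
Qed.

Lemma digit_pow2sum N i : i < N -> digit 2 (pow2sum N) i = is_pow2 i.
Proof.
move=> iN; rewrite -(digit_modn 2 _ (ltnSn i)) pow2sum_modn // pow2sumS /digit.
rewrite divnMDl ?expn_gt0 // divn_small ?ltn_pow2sum // addn0.
by case: is_pow2.
Qed.

(** A candidate agrees with [pow2sum] up to its leading bit and vanishes above it, so it is some
    [pow2sum t.+1]; monotonicity then gives the maximum. *)
Lemma K_pow2sum delta n : 0 < delta * n -> K (2 ^ delta) n = pow2sum (delta * n).
Proof.
move=> dn0; set D := delta * n.
have qD : (2 ^ delta) ^ n = 2 ^ D by rewrite -expnM.
have log_lt x : x < 2 ^ D -> trunc_log 2 x < D.
  move=> xD; have [->|x0] := posnP x; first by rewrite trunc_log0.
  rewrite -(ltn_exp2l (m := 2)) //; apply: leq_ltn_trans xD.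
  exact: trunc_logP.
have ltD : pow2sum D < (2 ^ delta) ^ n by rewrite qD ltn_pow2sum.
have ones : ones_at_pow2 (pow2sum D).
  apply/forallP => i; apply/eqP.
  have iD : i < D.
    by apply: leq_trans (ltn_ord i) _; apply: log_lt; rewrite ltn_pow2sum.
  by rewrite digit_pow2sum //; case: is_pow2.
apply/eqP; rewrite eqn_leq; apply/andP; split; last first.
  exact: (@leq_bigmax_cond _ _ (fun x : 'I_((2 ^ delta) ^ n) => x : nat) (Ordinal ltD)).
apply/bigmax_leqP => x /forallP onesx.
have xD : x < 2 ^ D by rewrite -qD.
set t := trunc_log 2 x; have tD : t < D by apply: log_lt.
apply: leq_trans (leq_pow2sum tD).
have xt : x < 2 ^ t.+1 by apply: trunc_log_ltn.
suff : x = pow2sum t.+1 %[mod 2 ^ t.+1].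
  by rewrite !modn_small ?ltn_pow2sum // => ->.
apply: modn_eq_digits => i it; rewrite digit_pow2sum //.
have /eqP <- := onesx (Ordinal it).
by rewrite /= /digit modn2; case: odd.
Qed.

Lemma is_pow2X j : is_pow2 (2 ^ j).
Proof. by apply/existsP; exists (Ordinal (ltn_expl j (isT : 1 < 2))). Qed.

Lemma pow2sum1 : pow2sum 1 = 0.
Proof.
rewrite /pow2sum big_ord_recl big_ord0 (_ : is_pow2 ord0 = false) //.
by apply/negbTE/negP => /existsP[[]].
Qed.

Lemma is_pow2_gap i j : 2 ^ j < i < 2 ^ j.+1 -> is_pow2 i = false.
Proof.
move=> /andP[lt gt]; apply/negbTE/negP => /existsP[k /eqP ik].
by move: lt gt; rewrite ik !ltn_exp2l // => jk; rewrite ltnS leqNgt jk.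
Qed.

(** No bit is added strictly between two consecutive powers of two. *)
Lemma pow2sum_gap j u : 2 ^ j < u <= 2 ^ j.+1 ->
  pow2sum u = 2 ^ 2 ^ j + pow2sum (2 ^ j).
Proof.
move=> /andP[]; elim: u => // u IH; rewrite ltnS leq_eqVlt => /predU1P[<- _|ju uj].
  by rewrite pow2sumS is_pow2X mul1n.
by rewrite pow2sumS (is_pow2_gap (j := j)) ?ju // IH // ltnW.
Qed.

(* Removing the leading term of the multiplier leaves a progression with
   difference [2 ^ s * Y'] inside each class of d modulo [2 ^ s]. *)
Lemma card_near_two_terms L p s Y' : 1 < s -> s + p = 2 * L -> s <= L ->
  2 ^ (L.+1 - s) <= Y' -> 2 ^ s * Y' * 2 ^ (L - s) <= 2 ^ L * 2 ^ L ->
  #|[set d : 'I_(2 ^ L) | near (2 ^ L) (2 ^ p + Y') d]| <= 2 ^ s * 2.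
Proof.
set N := 2 ^ L => s1 sp sL Y'lo Y'hi.
have N0 : 0 < N by rewrite expn_gt0.
have NN0 : 0 < N * N by rewrite muln_gt0 N0.
have NE : N = 2 ^ s * 2 ^ (L - s) by rewrite -expnD subnKC.
have spE : 2 ^ s * 2 ^ p = N * N by rewrite -!expnD sp mul2n addnn.
have s0 : 0 < 2 ^ s by rewrite expn_gt0.
pose f (d : 'I_N) := Ordinal (ltn_pmod d s0).
have := @card_fibres _ _ [set d : 'I_N | near N (2 ^ p + Y') d] f setT 2.
rewrite cardsT card_ord; apply=> [d _|u _]; first by rewrite inE.
set F := [set _ in _ | _].
have gP (d : 'I_N) : d %/ 2 ^ s < 2 ^ (L - s).
  by rewrite ltn_divLR // mulnC -NE.
pose g d := Ordinal (gP d).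
pose beta := (u * (2 ^ p + Y') + N.-1) %% (N * N).
have dE d : d \in F -> d = d %/ 2 ^ s * 2 ^ s + u :> nat.
  by rewrite !inE => /andP[_ /eqP <-]; rewrite -divn_eq.
rewrite -(card_in_imset (f := g)); last first.
  move=> x y /dE xE /dE yE /(congr1 val) /= e; apply: val_inj => /=.
  by rewrite xE yE e.
(* The difference is at least [2 * N], so a block holds at most one term per period. *)
have dbl : 2 * N <= 2 ^ s * Y'.
  have -> : 2 * N = 2 ^ s * 2 ^ (L.+1 - s).
    by rewrite -expnS -expnD; congr (_ ^ _); lia.
  by rewrite leq_mul2l Y'lo orbT.
apply: leq_trans (card_progression (alpha := 2 ^ s * Y') (beta := beta)
  (M := N * N) (W := N + N.-1) (U := 2 ^ (L - s)) (Q := 2) (V := 1) _ NN0 _ _).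
- apply/subset_leq_card/subsetP => _ /imsetP[d dF ->]; rewrite inE /= /beta modnDmr.
  have := dF; rewrite !inE => /andP[/(near_shift N0) + _].
  rewrite {1}(dE _ dF); set e := d %/ _.
  have -> : (e * 2 ^ s + u) * (2 ^ p + Y') + N.-1 =
    e * (2 ^ s * 2 ^ p) + (2 ^ s * Y' * e + (u * (2 ^ p + Y') + N.-1)) by lia.
  by rewrite spE modnMDl.
- by apply: leq_trans dbl; rewrite muln_gt0.
- move=> d dU; have : beta < N * N by rewrite ltn_mod.
  have : 2 ^ s * Y' * d <= 2 ^ s * Y' * 2 ^ (L - s) by rewrite leq_mul2l ltnW ?orbT.
  lia.
- lia.
Qed.

(** [d * Y] stays within [2 ^ (p.+1 - L)] periods of length [N * N], and [N <= Y] leaves at most two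
    terms per block. *)
Lemma card_near_size L p Y : L <= p -> 2 ^ p <= Y < 2 ^ p.+1 ->
  #|[set d : 'I_(2 ^ L) | near (2 ^ L) Y d]| <= 2 ^ (p.+1 - L) * 2.
Proof.
set N := 2 ^ L => Lp /andP[Ylo Yhi].
have N0 : 0 < N by rewrite expn_gt0.
have pE : 2 ^ p.+1 = 2 ^ (p.+1 - L) * N by rewrite -expnD subnK // ltnW.
have NY : N <= Y by apply: leq_trans Ylo; rewrite leq_pexp2l.
have := @card_progression Y N.-1 (N * N) (N + N.-1) N (2 ^ (p.+1 - L)) 2.
rewrite (leq_trans N0 NY) muln_gt0 N0 => /(_ isT isT) prog.
apply: leq_trans (prog _ _); last by lia.
  apply/subset_leq_card/subsetP => d; rewrite !inE mulnC => /(near_shift N0).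
  by rewrite mulnC.
move=> d dN; rewrite mulnA -pE.
have : (Y + 1) * N <= 2 ^ p.+1 * N by rewrite leq_mul2r addn1 Yhi orbT.
by nia.
Qed.

Lemma spread_pow2sum L M : 0 < L -> 2 * L <= M ->
  exists2 b, L <= 16 * b & spread L (pow2sum M) b.
Proof.
move=> L0 LM; have N0 : 0 < 2 ^ L by rewrite expn_gt0.
have nearE d : near (2 ^ L) (pow2sum M) d = near (2 ^ L) (pow2sum (2 * L)) d.
  by rewrite -near_modn -expnD addnn -mul2n pow2sum_modn.
(* [2 ^ j] is the largest power of two below [2 * L], hence the leading exponent of the reduced
   multiplier. *)
have [j /andP[Lp pL]] : exists j, L <= 2 ^ j < 2 * L.
  exists (up_log 2 L); rewrite up_logP //=.
  have [L1|L1] := leqP L 1; first by have -> : L = 1 by lia.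
  have := up_log_bounds (isT : 1 < 2) L1 => /andP[+ _].
  have : 0 < up_log 2 L by rewrite up_log_gt0.
  by case: (up_log 2 L) => // k _ /=; rewrite expnS; lia.
have YE : pow2sum (2 * L) = 2 ^ 2 ^ j + pow2sum (2 ^ j).
  by apply: pow2sum_gap; rewrite pL expnS leq_mul2l Lp.
have Yhi : pow2sum (2 * L) < 2 ^ (2 ^ j).+1.
  by rewrite YE expnS; have := ltn_pow2sum (2 ^ j); lia.
have [L16|L16] := ltnP L 16.
  (* One bit suffices here, and it only takes that the reduced multiplier lies between [N] and
     [N * N - N], where [N = 2 ^ L]. *)
  exists 1; first by lia.
  apply: spread1 => //; rewrite nearE /near mul1n modn_small; last first.
    by rewrite -expnD addnn -mul2n ltn_pow2sum.
  rewrite negb_or -!leqNgt.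
  have NY : 2 ^ L <= pow2sum (2 * L).
    by rewrite YE (leq_trans _ (leq_addr _ _)) // leq_pexp2l.
  rewrite NY /= -expnD addnn -mul2n.
  case: j Lp pL YE Yhi => [|j] Lp pL YE Yhi.
    have L1 : L = 1 by lia.
    by rewrite YE pow2sum1 L1.
  have : (2 ^ j.+1).+1 <= (2 * L).-1 by move: pL; rewrite expnS; lia.
  rewrite -(leq_exp2l (m := 2)) // => le.
  have : 2 ^ L <= 2 ^ (2 * L).-1 by rewrite leq_pexp2l //; lia.
  have -> : 2 ^ (2 * L) = 2 * 2 ^ (2 * L).-1 by rewrite -expnS prednK // muln_gt0.
  lia.
exists (L./2 - 4); first by have := odd_double_half L; case: (odd L); lia.
apply: spread_near.
have -> : [set d : 'I_(2 ^ L) | near (2 ^ L) (pow2sum M) d] =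
          [set d : 'I_(2 ^ L) | near (2 ^ L) (pow2sum (2 * L)) d].
  by apply/setP => d; rewrite !inE nearE.
have halfL := odd_double_half L.
have Ylo : 2 ^ 2 ^ j <= pow2sum (2 * L) by rewrite YE leq_addr.
(* With [s = 2 * L - 2 ^ j], the two counting bounds are [2 ^ (L - s + 2)] and [2 ^ (s + 1)]; the
   threshold balances them near [s = L / 2]. *)
have [s_big|s_small] := leqP (L./2 - 2) (2 * L - 2 ^ j).
  have /(card_near_size Lp) le : 2 ^ 2 ^ j <= pow2sum (2 * L) < 2 ^ (2 ^ j).+1 by rewrite Ylo.
  apply: leq_trans (leq_mul le (leqnn _)) _.
  rewrite -expnSr -expnD leq_pexp2l //.
  by case: (odd L) halfL; lia.
case: j Lp pL YE Yhi Ylo s_small => [|j] Lp pL YE Yhi Ylo s_small; first by lia.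
have Y'E : pow2sum (2 ^ j.+1) = 2 ^ 2 ^ j + pow2sum (2 ^ j).
  by apply: pow2sum_gap; rewrite leqnn andbT ltn_exp2l.
rewrite YE; set s := 2 * L - 2 ^ j.+1 in s_small.
have sE : s + 2 ^ j.+1 = 2 * L by rewrite /s subnK // ltnW.
(* [s] is positive and even, hence at least 2, which yields both size conditions on the remaining
   terms. *)
have sev : s + 2 * 2 ^ j = 2 * L by rewrite -expnS.
apply: leq_trans (leq_mul (card_near_two_terms (s := s) _ sE _ _ _) (leqnn _)) _.
- lia.
- lia.
- by rewrite Y'E (leq_trans _ (leq_addr _ _)) // leq_pexp2l //; lia.
- apply: (@leq_trans (2 ^ L * 2 ^ (2 ^ j).+1)).
    rewrite mulnAC -expnD subnKC; last by lia.
    rewrite leq_mul2l Y'E expnS; apply/orP; right.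
    by have := ltn_pow2sum (2 ^ j); lia.
  by rewrite -!expnD leq_pexp2l //; lia.
- rewrite -expnSr -expnD leq_pexp2l //.
  by case: (odd L) halfL; lia.
Qed.

(** * From information transfer to expected running time *)

Lemma sum_running_time_ge (I : finType) delta n w m (A : I -> algorithm w m nat)
    (Y : I -> nat) (q := 2 ^ delta) (k := trunc_log 2 n) :
  0 < n -> 0 < w -> m <= 2 ^ w ->
  (forall i (X : 'I_(q ^ n)), multiplies (A i) (digit q X) q n X (Y i)) ->
  (forall j, 2 ^ j.+1 <= n -> exists2 G : {set I}, #|I| <= 4 * #|G| &
     forall i, i \in G ->
       exists2 b, delta * 2 ^ j <= 16 * b & spread (delta * 2 ^ j) (Y i) b) ->
  delta * k * 2 ^ k * (#|I| * q ^ n) <=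
    512 * w * \sum_i \sum_(X < q ^ n) running_time (A i) (digit q X) n.
Proof.
move=> n0 w0 mw mul_ok sp; have kn : 2 ^ k <= n by apply: trunc_logP.
apply: leq_trans (sum_transfer_ge w0 mw mul_ok sp (a := 0) _) _; first by rewrite add0n.
rewrite leq_mul2l; apply/orP; right; apply: leq_sum => i _; apply: leq_sum => X _.
exact: transfer_le_running_time.
Qed.

Lemma expectation_unif_ge (R : realType) (T : finType) (f : T -> nat) delta n w
    (k := trunc_log 2 n) :
  0 < n -> 0 < w -> 0 < #|T| ->
  delta * k * 2 ^ k * #|T| <= 512 * w * \sum_t f t ->
  (2048%:R^-1 * (delta%:R / w%:R * n%:R * log2 R n) <= expectation_unif R f)%R.
Proof.
move=> n0 w0 T0 le.
have n_lt : n < 2 ^ k.+1 by apply: trunc_log_ltn.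
have ln2 : (0 < ln 2 :> R)%R by rewrite ln_gt0 // ltr1n.
(* By [n < 2 ^ k.+1], [n] is at most [2 * 2 ^ k] and its logarithm at most [2 * k]; this factor 4
   turns 512 into 2048. For [k = 0] the logarithm is 0. *)
have nlog : (n%:R * log2 R n <= (4 * (k * 2 ^ k))%:R)%R.
  have log_ge0 : (0 <= log2 R n)%R.
    by apply: divr_ge0; [rewrite ln_ge0 // ler1n|exact: ltW].
  have [k0|k0] := posnP k.
    have -> : n = 1 by move: n_lt; rewrite k0; lia.
    by rewrite /log2 ln1 mul0r mulr0.
  have log_le : (log2 R n <= (2 * k)%:R)%R.
    rewrite ler_pdivrMr // mulr_natl -lnXn //.
    rewrite ler_ln ?posrE ?ltr0n ?exprn_gt0 // -natrX ler_nat.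
    by apply: leq_trans (ltnW n_lt) _; rewrite leq_pexp2l //; lia.
  have n_le : (n%:R <= (2 * 2 ^ k)%:R :> R)%R by rewrite ler_nat -expnS ltnW.
  apply: le_trans (ler_pM _ log_ge0 n_le log_le) _ => //.
  by rewrite -natrM ler_nat; lia.
rewrite /expectation_unif ler_pdivlMr ?ltr0n // -natr_sum.
have w0R : (0 < w%:R :> R)%R by rewrite ltr0n.
have := le; rewrite -(ler_nat R) !natrM => {}le.
apply: (@le_trans _ _ (2048%:R^-1 * (delta%:R / w%:R * (4 * (k * 2 ^ k))%:R) * #|T|%:R)%R).
  rewrite ler_pM2r ?ltr0n // ler_pM2l ?invr_gt0 // -mulrA.
  by rewrite ler_wpM2l // divr_ge0.
rewrite !natrM -(ler_pM2l (_ : 0 < 512%:R * w%:R :> R)%R) ?mulr_gt0 //.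
apply: le_trans le; rewrite le_eqVlt; apply/orP; left; apply/eqP.
by field; rewrite gt_eqF.
Qed.

Local Open Scope ring_scope.

Theorem theorem3 (R : realType) :
  exists2 c : R, 0 < c &
  forall delta n w m : nat,
    (0 < delta)%N -> (0 < n)%N -> (0 < w)%N -> (m <= 2 ^ w)%N ->
    let q := (2 ^ delta)%N in
    let bound : R := c * (delta%:R / w%:R * n%:R * log2 R n) in
    [/\ (* the digits of X and Y arrive online, in pairs *)
        forall A : algorithm w m (nat * nat),
          (forall X Y : 'I_(q ^ n),
             multiplies A (digit_pairs q X Y) q n X Y) ->
          bound <= expectation_unif R
            (fun XY : 'I_(q ^ n) * 'I_(q ^ n) =>
               running_time A (digit_pairs q XY.1 XY.2) n),
        (* full access to Y from the start, the digits of X arrive online *)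
        forall A : 'I_(q ^ n) -> algorithm w m nat,
          (forall X Y : 'I_(q ^ n),
             multiplies (A Y) (digit q X) q n X Y) ->
          bound <= expectation_unif R
            (fun XY : 'I_(q ^ n) * 'I_(q ^ n) =>
               running_time (A XY.2) (digit q XY.1) n)
      & (* Y = K q n is fixed, the digits of X arrive online *)
        forall A : algorithm w m nat,
          (forall X : 'I_(q ^ n),
             multiplies A (digit q X) q n X (K q n)) ->
          bound <= expectation_unif R
            (fun X : 'I_(q ^ n) => running_time A (digit q X) n)].
Proof.
exists 2048%:R^-1; first by rewrite invr_gt0 ltr0n.
move=> delta n w m delta0 n0 w0 mw q bound.
have qn0 : (0 < q ^ n)%N by rewrite expn_gt0 expn_gt0.
have offline (A : 'I_(q ^ n) -> algorithm w m nat) :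
    (forall X Y : 'I_(q ^ n), multiplies (A Y) (digit q X) q n X Y) ->
    bound <= expectation_unif R (fun XY : 'I_(q ^ n) * 'I_(q ^ n) =>
               running_time (A XY.2) (digit q XY.1) n).
  move=> mul_ok; apply: expectation_unif_ge; rewrite ?card_prod ?card_ord ?muln_gt0 ?qn0 //.
  rewrite -(pair_bigA _ (fun X Y : 'I_(q ^ n) => running_time (A Y) (digit q X) n)) exchange_big /=.
  have := sum_running_time_ge (A := A) (Y := fun Y => Y : nat) n0 w0 mw (fun i X => mul_ok X i).
  rewrite card_ord; apply=> j jn.
  (* The range [q ^ n] consists of full periods, since here [N * N] is [q ^ (2 ^ j.+1)]. *)
  apply: (spread_most (R := (2 ^ (delta * (n - 2 ^ j.+1)))%N)).
  - by rewrite muln_gt0 delta0 expn_gt0.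
  - by rewrite expn_gt0.
  - by rewrite /q -expnM -!expnD; congr (_ ^ _)%N; move: jn; rewrite expnS; nia.
split=> // [A mul_ok|A mul_ok].
  (* Hardwiring the digits of [Y] reduces the paired case to that of full access. *)
  pose B (Y : 'I_(q ^ n)) := Algorithm (init A) (fun i x => step A i (x, digit q Y i)).
  by apply: (offline B) => X Y; apply: mul_ok.
apply: expectation_unif_ge; rewrite ?card_ord //.
have := sum_running_time_ge (I := 'I_1) (A := fun => A) (Y := fun => K q n) n0 w0 mw
  (fun _ => mul_ok).
rewrite card_ord big_ord1 mul1n; apply=> j jn.
exists setT => [|i _]; first by rewrite cardsT card_ord.
rewrite K_pow2sum ?muln_gt0 ?delta0 //; apply: spread_pow2sum.
  by rewrite muln_gt0 delta0 expn_gt0.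
by rewrite mulnCA -expnS leq_mul2l jn orbT.
Qed.
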